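(* Let $X\subset\mathbb{R}^n$ be a closed and convex semialgebraic set, and let $f\in\mathbb{R}[x]$, $x=(x_1,\dots,x_n)$, be a polynomial which has only positive values on $X$. Then there exists $N_0\in\mathbb{R}$ such that for any $N\ge N_0$ the function $\varPhi_N(x)=e^{e^{N|x|^2}}f(x)$ is strongly convex on $X$.
   Context: $|\cdot|$ is the Euclidean norm on $\mathbb{R}^n$. A function $\varphi$ is strongly convex on a convex set $X$ if for some $\mu>0$ the function $\varphi(x)-\frac{\mu}{2}|x|^2$ is convex on $X$. *)

(* Defs.v *)
(* MathComp-Analysis; the reals are an arbitrary [R : realType] and R^n is
   the type ['rV[R]_n] of row vectors. *)
From mathcomp Require Import all_boot all_order all_algebra.
From mathcomp Require Import all_classical all_reals all_analysis.
(* Not imported: the notations of mpoly clash with those of analysis. *)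
From mathcomp Require mpoly.

Set Implicit Arguments.
Unset Strict Implicit.
Unset Printing Implicit Defensive.

Import Order.TTheory GRing.Theory Num.Theory.
Import numFieldNormedType.Exports.

Local Open Scope classical_set_scope.
Local Open Scope ring_scope.

Definition peval (R : realType) (n : nat) (p : mpoly.mpoly n R)
    (x : 'rV[R]_n) : R :=
  mpoly.meval (fun i => x ord0 i) p.

(* The norm [`|x|] that the library puts on ['rV[R]_n] is the sup norm; the
   two norms induce the same topology, so [closed] keeps its usual meaning. *)
Definition enorm (R : realType) (n : nat) (x : 'rV[R]_n) : R :=
  Num.sqrt (\sum_(i < n) x ord0 i ^+ 2).

(* [{x | p(x) = 0 for p in ps, q(x) > 0 for q in qs}] *)
Definition basic_semialgebraic_set (R : realType) (n : nat)
    (ps qs : seq (mpoly.mpoly n R)) : set 'rV[R]_n :=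
  [set x | all (fun p => peval p x == 0) ps && all (fun q => 0 < peval q x) qs].

Definition semialgebraic (R : realType) (n : nat) (X : set 'rV[R]_n) : Prop :=
  exists F : seq (seq (mpoly.mpoly n R) * seq (mpoly.mpoly n R)),
    X = \big[setU/set0]_(b <- F) basic_semialgebraic_set b.1 b.2.

Definition strongly_convex (R : realType) (n : nat) (X : set 'rV[R]_n)
    (phi : 'rV[R]_n -> R) : Prop :=
  exists2 mu : R, 0 < mu &
    convex_function X (fun x => phi x - mu / 2 * enorm x ^+ 2).

Definition Phi (R : realType) (n : nat) (f : mpoly.mpoly n R) (N : R)
    (x : 'rV[R]_n) : R :=
  expR (expR (N * enorm x ^+ 2)) * peval f x.

(* Main.v *)
Require Import Defs.
From mathcomp Require Import all_boot all_order all_algebra.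
From mathcomp Require Import all_classical all_reals all_analysis.
From mathcomp Require Import -(notations) mpoly.
From mathcomp Require Import -(notations) ordered_qelim.
From mathcomp Require qe_rcf polyrcf.
From mathcomp Require Import ring lra.

(** Along a line [x + t *: v], with [r = |x + t v|^2], [h = exp (N r)] and
    [q] the restriction of [f], the second derivative of [exp h * q] is
    [exp h] times
      [(h')^2 q + 2 h' q' + h'' q + q''],   [h'' >= 2 N |v|^2 h].
    Completing the square in [h'] bounds this below by
    [2 N |v|^2 h q - q'^2 / q + q''].  Here [q'] and [q''] grow at most
    polynomially in [r], whereas [h] beats any prescribed power of [1 + r] once
    [N] is large.  So everything comes down to preventing [f], which is positive
    on [X], from decaying faster than a power of [1 / (1 + r)].

    That lower bound ([semialgebraic_lower_bound]) is where semialgebraicity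
    enters.  The set of pairs [(t, y)] such that [f] takes the value [y] at some
    point of [X] with [|x|^2 <= t] is, by elimination of quantifiers over the
    real closed field [R], described by a quantifier-free formula in [t] and [y]
    ([values_semialgebraic]).  A polynomial in [(t, y)] has constant sign on a
    cusp [0 < y < c (1 + t)^(-k)], [t >= t0], because there it is dominated by
    its lowest nonzero coefficient as a polynomial in [y]
    ([sgr_poly2_on_cusp]); hence a quantifier-free formula has constant truth
    value on some cusp ([formula_on_cusp]).  The minimum [m] of [f] over the
    compact set of the [x] in [X] with [|x|^2 <= t] is a value of [f] and
    [m / 2] is not, so [(t, m)] and [(t, m / 2)] cannot both lie in the cusp:
    [m >= c (1 + t)^(-k)].

    The estimate of the second derivative is [expexp_d2_ge0]; subtracting
    [|x|^2 / 2] costs only [|v|^2], so [mu = 1] serves for every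
    large [N]. *)

Import Order.TTheory GRing.Theory Num.Theory.
Import numFieldNormedType.Exports.
Local Open Scope classical_set_scope.
Local Open Scope ring_scope.
Set Implicit Arguments.
Unset Strict Implicit.
Unset Printing Implicit Defensive.

(** * Polynomials as functions on Euclidean space *)

Section Polynomials.
Variables (R : realType) (n : nat).
Implicit Types (p q : mpoly n R) (x v : 'rV[R]_n).

(** Continuity, growth, differentiation and reification all commute with the
    ring operations, so they are proved by induction on a ring expression
    rather than on the list of monomials. *)
Lemma mpoly_ring_ind (P : mpoly n R -> Prop) :
  (forall c, P (mpolyC n c)) -> (forall i, P (mpolyX R (mnm1 i))) ->
  (forall p q, P p -> P q -> P (p + q)) ->
  (forall p q, P p -> P q -> P (p * q)) -> forall p, P p.
Proof.
move=> PC PX PD PM p; elim/mpolyind: p => [|c m p _ _ Pp].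
  by rewrite -mpolyC0.
apply: (PD) => //; rewrite -mul_mpolyC; apply: (PM) => //; rewrite mpolyXE_id.
have P1 : P 1 by rewrite -mpolyC1.
apply: (big_ind P) => // i _.
by elim: (m i) => [|k IHk]; rewrite ?expr0// exprS; apply: PM.
Qed.

Lemma pevalC c x : peval (mpolyC n c) x = c.
Proof. exact: mevalC. Qed.

Lemma pevalX i x : peval (mpolyX R (mnm1 i)) x = x ord0 i.
Proof. exact: mevalXU. Qed.

Lemma pevalD p q x : peval (p + q) x = peval p x + peval q x.
Proof. exact: mevalD. Qed.

Lemma pevalM p q x : peval (p * q) x = peval p x * peval q x.
Proof. exact: mevalM. Qed.

Lemma pevalZ c p x : peval (c *: p) x = c * peval p x.
Proof. exact: mevalZ. Qed.

Lemma peval_sum (I : finType) (F : I -> mpoly n R) x :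
  peval (\sum_i F i) x = \sum_i peval (F i) x.
Proof. exact: (big_morph (fun p => peval p x) (fun p q => pevalD p q x) (meval0 _)). Qed.

(** Making [|x|^2] a polynomial gives its continuity and lets it occur in
    formulas. *)
Definition sqnorm_mpoly : mpoly n R :=
  \sum_(i < n) mpolyX R (mnm1 i) * mpolyX R (mnm1 i).

Lemma enorm_sqr x : enorm x ^+ 2 = \sum_(i < n) x ord0 i ^+ 2.
Proof. by rewrite sqr_sqrtr// sumr_ge0// => i _; rewrite sqr_ge0. Qed.

Lemma peval_sqnorm x : peval sqnorm_mpoly x = enorm x ^+ 2.
Proof.
rewrite enorm_sqr peval_sum; apply: eq_bigr => i _.
by rewrite pevalM !pevalX expr2.
Qed.

Lemma peval_continuous p : continuous (peval p : 'rV[R]_n -> R).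
Proof.
elim/mpoly_ring_ind: p => [c|i|p q cp cq|p q cp cq] x.
- by rewrite (funext (pevalC c)); exact: cst_continuous.
- rewrite (funext (pevalX i)); exact: coord_continuous.
- rewrite (funext (pevalD p q)); exact: cvgD (cp x) (cq x).
- rewrite (funext (pevalM p q)); exact: cvgM (cp x) (cq x).
Qed.

Lemma compact_ball (X : set 'rV[R]_n) (t : R) :
  closed X -> compact (X `&` [set x | enorm x ^+ 2 <= t]).
Proof.
move=> Xclosed; apply: bounded_closed_compact.
  exists (1 + t); split; first exact: num_real.
  move=> M tM x [_ /= xt]; apply: ltW; apply: le_lt_trans tM.
  have t0 : 0 <= t by apply: le_trans xt; rewrite sqr_ge0.
  rewrite [leLHS]/Num.norm/= mx_normrE; apply/bigmax_leP; split => [|[i j] _ /=].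
    by rewrite addr_ge0.
  have : x i j ^+ 2 <= t.
    apply: le_trans xt; rewrite enorm_sqr (bigD1 j)//= (ord1 i) lerDl.
    by rewrite sumr_ge0// => k _; rewrite sqr_ge0.
  by rewrite -[x i j ^+ 2]real_normK ?num_real//; nra.
apply: closedI => //.
rewrite (_ : [set x | _] = peval sqnorm_mpoly @^-1` [set y | y <= t]).
  have /continuous_closedP := @peval_continuous sqnorm_mpoly.
  by apply; exact: closed_le.
by apply/seteqP; split => x /=; rewrite peval_sqnorm.
Qed.

(** The degree [d] in [v] is recorded separately because the directional
    derivatives must be compared with [|v|^2], uniformly in [v]. *)
Definition poly_bounded (d : nat) (F : 'rV[R]_n -> 'rV[R]_n -> R) : Prop :=
  exists C k, 0 <= C /\
    forall v x, `|F v x| <= C * enorm v ^+ d * (1 + enorm x ^+ 2) ^+ k.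

Lemma enorm_ge0 x : 0 <= enorm x. Proof. exact: sqrtr_ge0. Qed.

Lemma weight_ge1 x : 1 <= 1 + enorm x ^+ 2.
Proof. by rewrite lerDl sqr_ge0. Qed.

Lemma normr_coord_le v i : `|v ord0 i| <= enorm v.
Proof.
rewrite -ler_sqr ?nnegrE ?enorm_ge0// enorm_sqr (bigD1 i)//=.
rewrite real_normK ?num_real// lerDl.
by rewrite sumr_ge0// => k _; rewrite sqr_ge0.
Qed.

Lemma poly_boundedD d F G : poly_bounded d F -> poly_bounded d G ->
  poly_bounded d (fun v x => F v x + G v x).
Proof.
move=> [C [k [C0 FC]]] [D [l [D0 GD]]]; exists (C + D), (k + l)%N.
split=> [|v x]; first exact: addr_ge0.
apply: le_trans (ler_normD _ _) _; rewrite mulrDl mulrDl.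
have w1 := weight_ge1 x; have vd : 0 <= enorm v ^+ d by rewrite exprn_ge0 ?enorm_ge0.
apply: lerD; [apply: le_trans (FC v x) _|apply: le_trans (GD v x) _];
  apply: ler_wpM2l; rewrite ?mulr_ge0//; apply: ler_weXn2l => //;
  by rewrite (leq_addr, leq_addl).
Qed.

Lemma poly_boundedM d e F G : poly_bounded d F -> poly_bounded e G ->
  poly_bounded (d + e) (fun v x => F v x * G v x).
Proof.
move=> [C [k [C0 FC]]] [D [l [D0 GD]]]; exists (C * D), (k + l)%N.
split=> [|v x]; first exact: mulr_ge0.
rewrite normrM; apply: le_trans (ler_pM _ _ (FC v x) (GD v x)) _ => //.
by rewrite !exprD le_eqVlt; apply/orP; left; apply/eqP; ring.
Qed.

Lemma poly_bounded_sum d (F : 'I_n -> 'rV[R]_n -> 'rV[R]_n -> R) :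
  (forall i, poly_bounded d (F i)) ->
  poly_bounded d (fun v x => \sum_(i < n) F i v x).
Proof.
move=> Fb.
(* The sum is taken in the space of functions, so that closure under binary
   sums applies term by term. *)
pose S := \big[(fun G H v x => G v x + H v x)/(fun _ _ => 0)]_(i < n) F i.
have -> : (fun v x => \sum_(i < n) F i v x) = S.
  apply/funext => v; apply/funext => x.
  by rewrite /S (@big_morph _ _ (fun G => G v x) 0 +%R).
rewrite {}/S; apply: (big_ind (poly_bounded d)) => //; last first.
  by move=> F1 F2 b1 b2; exact: poly_boundedD.
exists 0, 0%N; split=> // v x.
by rewrite normr0 !mul0r.
Qed.

Lemma poly_bounded_coord i : poly_bounded 1 (fun v _ => v ord0 i).
Proof.
by exists 1, 0%N; split=> // v x; rewrite mul1r expr1 expr0 mulr1 normr_coord_le.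
Qed.

Lemma poly_bounded_peval p : poly_bounded 0 (fun _ x => peval p x).
Proof.
elim/mpoly_ring_ind: p => [c|i|p q bp bq|p q bp bq].
- by exists `|c|, 0%N; split=> // v x; rewrite pevalC !expr0 !mulr1.
- exists 1, 1%N; split=> // v x; rewrite pevalX expr0 !mul1r expr1.
  apply: le_trans (normr_coord_le x i) _.
  by have := sqr_ge0 (enorm x - 1); nra.
- by under eq_fun do under eq_fun do rewrite pevalD; exact: poly_boundedD.
- by under eq_fun do under eq_fun do rewrite pevalM; exact: (@poly_boundedM 0 0).
Qed.

Definition dirderiv v p : mpoly n R := \sum_(i < n) v ord0 i *: mderiv i p.

Lemma peval_dirderiv v p x :
  peval (dirderiv v p) x = \sum_(i < n) v ord0 i * peval (mderiv i p) x.
Proof. by rewrite peval_sum; apply: eq_bigr => i _; rewrite pevalZ. Qed.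

Lemma mderiv_dirderiv i v p : mderiv i (dirderiv v p) = dirderiv v (mderiv i p).
Proof.
rewrite /dirderiv raddf_sum; apply: eq_bigr => j _.
by rewrite /= mderivZ mderiv_comm.
Qed.

Lemma poly_bounded_dirderiv p :
  poly_bounded 1 (fun v x => peval (dirderiv v p) x).
Proof.
under eq_fun do under eq_fun do rewrite peval_dirderiv.
apply: poly_bounded_sum => i.
exact: poly_boundedM (poly_bounded_coord i) (poly_bounded_peval _).
Qed.

Lemma poly_bounded_dirderiv2 p :
  poly_bounded 2 (fun v x => peval (dirderiv v (dirderiv v p)) x).
Proof.
under eq_fun do under eq_fun do rewrite peval_dirderiv.
apply: poly_bounded_sum => i.
under eq_fun do under eq_fun do rewrite mderiv_dirderiv.
exact: poly_boundedM (poly_bounded_coord i) (poly_bounded_dirderiv _).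
Qed.

Lemma is_derive_peval_line p x v (t : R) :
  is_derive t 1 (fun s => peval p (x + s *: v))
    (peval (dirderiv v p) (x + t *: v)).
Proof.
elim/mpoly_ring_ind: p => [c|i|p q dp dq|p q dp dq].
- under eq_fun do rewrite pevalC.
  rewrite peval_dirderiv big1; first exact: is_derive_cst.
  by move=> i _; rewrite mderivC -mpolyC0 pevalC mulr0.
- rewrite (_ : (fun _ => _) =
    horner ((x ord0 i)%:P + v ord0 i *: 'X)); last first.
    by apply/funext => s; rewrite pevalX !mxE !hornerE mulrC.
  rewrite peval_dirderiv (bigD1 i)//= big1 => [|j ji].
    rewrite addr0 mderivX mnm1E eqxx scale1r.
    rewrite (_ : mnm_sub _ _ = mnm0) ?mpolyX0; last first.
      by apply/mnmP => j; rewrite mnmBE mnm0E subnn.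
    rewrite -mpolyC1 pevalC mulr1.
    apply: (is_derive_eq (is_derive_poly _ _)).
    by rewrite derivD derivC derivZ derivX add0r !hornerE.
  by rewrite mderivX mnm1E eq_sym (negPf ji) scale0r -mpolyC0 pevalC mulr0.
- under eq_fun do rewrite pevalD.
  apply: (is_derive_eq (is_deriveD dp dq)).
  rewrite !peval_dirderiv -big_split; apply: eq_bigr => i _ /=.
  by rewrite mderivD pevalD mulrDr.
- under eq_fun do rewrite pevalM.
  apply: (is_derive_eq (is_deriveM dp dq)).
  rewrite !peval_dirderiv /GRing.scale/= !mulr_sumr -big_split.
  apply: eq_bigr => i _ /=; rewrite mderivM pevalD !pevalM; ring.
Qed.

End Polynomials.

(** * Elimination of quantifiers *)

Section Elimination.
Variables (R : realType) (n : nat).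
Implicit Types (p : mpoly n R) (x : 'rV[R]_n).

Definition coords x : seq R := [seq x ord0 i | i <- enum 'I_n].

Lemma nth_coords x (i : 'I_n) : (coords x)`_i = x ord0 i.
Proof. by rewrite (nth_map i) ?size_enum_ord// nth_ord_enum. Qed.

Lemma coordsP (s : seq R) : size s = n -> exists x, coords x = s.
Proof.
move=> sn; exists (\row_i s`_i); apply: (@eq_from_nth _ 0).
  by rewrite size_map size_enum_ord.
rewrite size_map size_enum_ord => i ltin.
by rewrite (nth_coords _ (Ordinal ltin)) mxE.
Qed.

(** Variables 0 and 1 of a formula stand for the parameters [t] and [y]; the
    coordinates of [x] follow, so that quantifying over [x] binds a final
    block of variables.  The condition [rformula] excludes inverses, as the
    elimination of quantifiers requires. *)
Definition defines (P : 'rV[R]_n -> R -> R -> Prop) : Prop :=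
  exists phi : ord.formula R, ord.rformula phi /\
    forall x t y, ord.holds ([:: t; y] ++ coords x) phi <-> P x t y.

Lemma mpoly_term p : exists tau : GRing.term R, GRing.rterm tau /\
  forall x t y, GRing.eval ([:: t; y] ++ coords x) tau = peval p x.
Proof.
elim/mpoly_ring_ind: p => [c|i|p q [a [ra pa]] [b [rb qb]]|p q [a [ra pa]] [b [rb qb]]].
- by exists (GRing.Const c); split=> // x t y; rewrite pevalC.
- by exists (GRing.Var R i.+2); split=> // x t y; rewrite pevalX /= nth_coords.
- exists (GRing.Add a b); split=> [|x t y]; first by rewrite /= ra.
  by rewrite pevalD /= pa qb.
- exists (GRing.Mul a b); split=> [|x t y]; first by rewrite /= ra.
  by rewrite pevalM /= pa qb.
Qed.

Lemma definesW P Q : (forall x t y, P x t y <-> Q x t y) -> defines P -> defines Q.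
Proof.
move=> PQ [phi [rphi phiP]]; exists phi; split=> // x t y.
by rewrite phiP.
Qed.

Lemma defines_and P Q : defines P -> defines Q ->
  defines (fun x t y => P x t y /\ Q x t y).
Proof.
move=> [phi [rphi phiP]] [psi [rpsi psiP]]; exists (ord.And phi psi).
by split=> [|x t y]; rewrite /= ?rphi// -phiP -psiP.
Qed.

Lemma defines_or P Q : defines P -> defines Q ->
  defines (fun x t y => P x t y \/ Q x t y).
Proof.
move=> [phi [rphi phiP]] [psi [rpsi psiP]]; exists (ord.Or phi psi).
by split=> [|x t y]; rewrite /= ?rphi// -phiP -psiP.
Qed.

Lemma defines_bool (b : bool) : defines (fun _ _ _ => b).
Proof. by exists (ord.Bool b). Qed.

Lemma defines_semialgebraic (X : set 'rV[R]_n) : semialgebraic X ->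
  defines (fun x _ _ => X x).
Proof.
case=> F ->; elim: F => [|[ps qs] F IHF].
  apply: definesW (defines_bool false) => x _ _.
  by rewrite big_nil; split=> // -[].
rewrite big_cons; apply: defines_or => //= {F IHF}.
have dps : defines (fun x _ _ => all (fun p => peval p x == 0) ps).
  elim: ps => [|p ps IHps]; first exact: defines_bool.
  have [tau [rtau tauP]] := mpoly_term p.
  apply: (@definesW (fun x _ _ => peval p x == 0 /\ all (fun p => peval p x == 0) ps)).
    by move=> x t y; split=> [[/= -> ->]|/= /andP].
  apply: defines_and => //; exists (ord.Equal tau (GRing.NatConst R 0)).
  split=> [|x t y]; first by rewrite /= rtau.
  by rewrite /= tauP; split=> /eqP.
have dqs : defines (fun x _ _ => all (fun q => 0 < peval q x) qs).
  elim: qs => [|q qs IHqs]; first exact: defines_bool.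
  have [tau [rtau tauP]] := mpoly_term q.
  apply: (@definesW (fun x _ _ => 0 < peval q x /\ all (fun q => 0 < peval q x) qs)).
    by move=> x t y; split=> [[/= -> ->]|/= /andP].
  apply: defines_and => //; exists (ord.Lt (GRing.NatConst R 0) tau).
  split=> [|x t y]; first by rewrite /= rtau.
  by rewrite /= tauP.
apply: (definesW _ (defines_and dps dqs)) => x t y.
by rewrite /basic_semialgebraic_set/=; split=> /andP.
Qed.

(** Quantifying the variable just beyond the end of an environment appends a
    value to it, so a block of quantifiers appends an arbitrary sequence. *)
Lemma holds_exists_block (e : seq R) (phi : ord.formula R) (k : nat) :
  ord.holds e (foldr ord.Exists phi (iota (size e) k)) <->
  exists2 s, size s = k & ord.holds (e ++ s) phi.
Proof.
elim: k e => [|k IHk] e /=.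
  by split=> [|[s /size0nil ->]]; rewrite ?cats0// => h; exists [::]; rewrite ?cats0.
have snoc z : set_nth 0 e (size e) z = rcons e z.
  by rewrite set_nthE ltnn subnn /= cats1.
split=> [[z]|[[//|z s] [sk]]].
  rewrite snoc -(size_rcons e z) IHk => -[s sk].
  by rewrite cat_rcons => h; exists (z :: s); rewrite //= sk.
rewrite -cat_rcons => h; exists z.
by rewrite snoc -(size_rcons e z) IHk; exists s.
Qed.

Lemma defines_exists_qf P : defines P ->
  exists theta : ord.formula R, [/\ ord.qf_form theta, ord.rformula theta &
    forall t y, ord.qf_eval [:: t; y] theta <-> exists x, P x t y].
Proof.
move=> [phi [rphi phiP]].
pose psi := foldr ord.Exists phi (iota 2 n).
have rpsi : ord.rformula psi by rewrite /psi; elim: (iota _ _).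
have wf := @qe_rcf.wf_QE_wproj R; have val := @qe_rcf.valid_QE_wproj R.
exists (ord.quantifier_elim (fun i bc => qe_rcf.qfr_to_formula (qe_rcf.wproj i bc)) psi).
have /andP[-> ->] := ord.quantifier_elim_wf wf rpsi; split=> // t y.
rewrite -(rwP (ord.quantifier_elim_rformP wf val _ rpsi)).
rewrite (holds_exists_block [:: t; y]); split=> [[s sn h]|[x Px]].
  by have [x xs] := coordsP sn; exists x; rewrite -phiP xs.
by exists (coords x); [rewrite size_map size_enum_ord|rewrite phiP].
Qed.

Lemma values_semialgebraic (X : set 'rV[R]_n) p q : semialgebraic X ->
  exists theta : ord.formula R, [/\ ord.qf_form theta, ord.rformula theta &
    forall t y, ord.qf_eval [:: t; y] theta <->
      exists x, [/\ X x, peval q x <= t & peval p x = y]].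
Proof.
move=> /defines_semialgebraic dX; apply: defines_exists_qf.
have [a [ra pa]] := mpoly_term p; have [b [rb qb]] := mpoly_term q.
apply: (@definesW (fun x t y => X x /\ (peval q x <= t /\ peval p x = y))).
  by move=> x t y; split=> [[? [? ?]]|[]].
apply: defines_and => //; apply: defines_and.
  exists (ord.Le b (GRing.Var R 0)); split=> [|x t y]; first by rewrite /= rb.
  by rewrite /= qb.
exists (ord.Equal a (GRing.Var R 1)); split=> [|x t y]; first by rewrite /= ra.
by rewrite /= pa.
Qed.

End Elimination.

(** * Formulas in two variables near a cusp at infinity *)

Section Cusps.
Variable R : realType.
Implicit Types (A B : R -> R -> Prop) (a : {poly R}) (p : {poly {poly R}}).

(** Cusps [0 < y < c (1 + t)^(-k)], [t0 <= t], are thin enough to avoid the zero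
    curves of any given polynomial in [(t, y)] other than the axis [y = 0], yet
    wide enough to detect a decay in [t] that is faster than polynomial. *)
Definition on_cusp A : Prop := exists t0 c k, [/\ 0 <= t0, 0 < c &
  forall t y, t0 <= t -> 0 < y -> y * (1 + t) ^+ k < c -> A t y].

Lemma on_cuspW A B : (forall t y, A t y -> B t y) -> on_cusp A -> on_cusp B.
Proof.
move=> AB [t0 [c [k [t00 c0 h]]]]; exists t0, c, k; split=> // t y *.
exact/AB/h.
Qed.

Lemma on_cusp_and A B : on_cusp A -> on_cusp B ->
  on_cusp (fun t y => A t y /\ B t y).
Proof.
move=> [t0 [c [k [t00 c0 hA]]]] [t1 [d [l [t10 d0 hB]]]].
exists (t0 + t1), (Num.min c d), (k + l)%N; split=> [||t y tt y0].
- exact: addr_ge0.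
- by rewrite lt_min c0.
have t1_ge1 : 1 <= 1 + t by lra.
rewrite lt_min => /andP[yc yd]; split.
- apply: hA => //; first by lra.
  apply: le_lt_trans yc; rewrite ler_pM2l//.
  by apply: ler_weXn2l; rewrite ?leq_addr.
- apply: hB => //; first by lra.
  apply: le_lt_trans yd; rewrite ler_pM2l//.
  by apply: ler_weXn2l; rewrite ?leq_addl.
Qed.

Lemma poly_growth a : exists C k, 0 <= C /\
  forall t, 0 <= t -> `|a.[t]| <= C * (1 + t) ^+ k.
Proof.
elim/poly_ind: a => [|a c [C [k [C0 IH]]]].
  by exists 0, 0%N; split=> // t _; rewrite horner0 normr0 mul0r.
exists (C + `|c|), k.+1; split=> [|t t0]; first by rewrite addr_ge0.
rewrite hornerMXaddC; apply: le_trans (ler_normD _ _) _; rewrite mulrDl.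
have w1 : 1 <= (1 + t) ^+ k.+1 by rewrite exprn_ege1// lerDl.
apply: lerD; last by rewrite ler_peMr.
rewrite normrM (ger0_norm t0) exprSr mulrA; apply: ler_pM => //; last by lra.
exact: IH.
Qed.

Lemma poly2_growth p : exists C k, 0 <= C /\
  forall t y, 0 <= t -> `|y| <= 1 -> `|p.[y%:P].[t]| <= C * (1 + t) ^+ k.
Proof.
elim/poly_ind: p => [|p a [C [k [C0 IH]]]].
  by exists 0, 0%N; split=> // t y _ _; rewrite !horner0 normr0 mul0r.
have [D [l [D0 aD]]] := poly_growth a.
exists (C + D), (k + l)%N; split=> [|t y t0 y1]; first exact: addr_ge0.
have w1 : 1 <= 1 + t by lra.
rewrite hornerMXaddC !hornerE; apply: le_trans (ler_normD _ _) _; rewrite mulrDl.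
apply: lerD.
  rewrite normrM -[leRHS]mulr1; apply: ler_pM => //.
  apply: le_trans (IH t y t0 y1) _; apply: ler_wpM2l => //.
  by apply: ler_weXn2l; rewrite ?leq_addr.
apply: le_trans (aD t t0) _; apply: ler_wpM2l => //.
by apply: ler_weXn2l; rewrite ?leq_addl.
Qed.

(** Multiplying by the sign of the leading coefficient reduces to a polynomial
    that tends to [+oo] or is a positive constant. *)
Lemma poly_eventually_large a : a != 0 -> exists t0 eps, [/\ 0 <= t0, 0 < eps &
  forall t, t0 <= t -> eps <= Num.sg (lead_coef a) * a.[t]].
Proof.
move=> a0; pose b := Num.sg (lead_coef a) *: a.
have lb : lead_coef b = `|lead_coef a|.
  by rewrite /b lead_coefZ -normrEsg.
have lb0 : 0 < lead_coef b by rewrite lb normr_gt0 lead_coef_eq0.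
have [t0 h] := polyrcf.poly_pinfty_gt_lc lb0.
exists (Num.max 0 t0), (lead_coef b); split=> // [|t]; first by rewrite le_max lexx.
by rewrite ge_max => /andP[_ /h]; rewrite hornerZ.
Qed.

(** Write the polynomial as [p y + a] with [a] depending on [t] only.  If
    [a = 0], the sign is that of [p] since [y > 0].  Otherwise [|a(t)|] is
    bounded below for large [t], while [|p y|] is smaller than any constant on
    a thin enough cusp: the sign is the one of [a] at infinity. *)
Lemma sgr_poly2_on_cusp p : exists s, on_cusp (fun t y => Num.sg p.[y%:P].[t] = s).
Proof.
elim/poly_ind: p => [|p a [s IH]].
  by exists 0, 0, 1, 0%N; split=> // t y _ _ _; rewrite !horner0 sgr0.
have [->|a0] := eqVneq a 0.
  exists s; case: IH => t0 [c [k [t00 c0 h]]]; exists t0, c, k; split=> // t y tt y0 yc.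
  by rewrite addr0 hornerMX hornerM hornerC sgrM (gtr0_sg y0) mulr1; apply: h.
exists (Num.sg (lead_coef a)).
have [t0 [eps [t00 eps0 aeps]]] := poly_eventually_large a0.
have [C [k [C0 pC]]] := poly2_growth p.
have C1 : 0 < C + 1 by lra.
exists t0, (Num.min 1 (eps / (C + 1))), k; split=> // [|t y tt y0].
  by rewrite lt_min ltr01 divr_gt0.
rewrite lt_min ltr_pdivlMr// => /andP[y1 yeps].
have w1 : 1 <= (1 + t) ^+ k by rewrite exprn_ege1//; lra.
have yle1 : y < 1 by apply: le_lt_trans y1; rewrite ler_peMr// ltW.
have {pC} pC : `|p.[y%:P].[t]| <= C * (1 + t) ^+ k.
  by apply: pC; [lra|rewrite ger0_norm ltW].
have {aeps} aeps := aeps t tt.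
rewrite hornerMXaddC hornerD hornerM hornerC.
set P := p.[y%:P].[t] in pC *; set W := (1 + t) ^+ k in y1 w1 pC yeps.
have Py : `|P * y| < eps.
  rewrite normrM (gtr0_norm y0); apply: le_lt_trans yeps; nra.
move: Py; rewrite ltr_norml => /andP[Py1 Py2].
have [l0|l0|l0] := ltgtP (lead_coef a) 0.
- by move: aeps; rewrite (ltr0_sg l0) => aeps; apply: ltr0_sg; lra.
- by move: aeps; rewrite (gtr0_sg l0) => aeps; apply: gtr0_sg; lra.
- by move/eqP: l0; rewrite lead_coef_eq0 (negPf a0).
Qed.

Lemma term_poly2 (tau : GRing.term R) : GRing.rterm tau ->
  exists p, forall t y, GRing.eval [:: t; y] tau = p.[y%:P].[t].
Proof.
elim: tau => //=.
- case=> [|[|i]] _.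
  + by exists ('X%:P) => t y; rewrite hornerC hornerX.
  + by exists 'X => t y; rewrite hornerX hornerC.
  + by exists 0 => t y; rewrite /= !horner0 nth_nil.
- by move=> c _; exists (c%:P%:P) => t y; rewrite !hornerC.
- by move=> m _; exists (m%:R) => t y; rewrite -!polyC_natr !hornerC.
- move=> u IHu v IHv /andP[/IHu[p pE] /IHv[q qE]].
  by exists (p + q) => t y; rewrite !hornerD pE qE.
- by move=> u IHu /IHu[p pE]; exists (- p) => t y; rewrite !hornerN pE.
- move=> u IHu m /IHu[p pE]; exists (p *+ m) => t y.
  by rewrite !hornerMn pE.
- move=> u IHu v IHv /andP[/IHu[p pE] /IHv[q qE]].
  by exists (p * q) => t y; rewrite !hornerM pE qE.
- move=> u IHu m /IHu[p pE]; exists (p ^+ m) => t y.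
  by rewrite !horner_exp pE.
Qed.

(** The three atomic relations between two terms only depend on the sign of
    their difference. *)
Lemma atom_on_cusp (u v : GRing.term R) : GRing.rterm u -> GRing.rterm v ->
  exists s, on_cusp (fun t y =>
    Num.sg (GRing.eval [:: t; y] u - GRing.eval [:: t; y] v) = s).
Proof.
move=> /term_poly2[p pE] /term_poly2[q qE].
have [s h] := sgr_poly2_on_cusp (p - q); exists s.
by apply: on_cuspW h => t y; rewrite !hornerE pE qE.
Qed.

Lemma formula_on_cusp (theta : ord.formula R) :
  ord.qf_form theta -> ord.rformula theta ->
  exists b, on_cusp (fun t y => ord.qf_eval [:: t; y] theta = b).
Proof.
elim: theta => //=.
- by move=> b _ _; exists b, 0, 1, 0%N; split.
- move=> u v _ /andP[ru rv]; have [s h] := atom_on_cusp ru rv; exists (s == 0).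
  by apply: on_cuspW h => t y <-; rewrite sgr_eq0 subr_eq0.
- move=> u v _ /andP[ru rv]; have [s h] := atom_on_cusp ru rv; exists (s < 0).
  by apply: on_cuspW h => t y <-; rewrite sgr_lt0 subr_lt0.
- move=> u v _ /andP[ru rv]; have [s h] := atom_on_cusp ru rv; exists (s <= 0).
  by apply: on_cuspW h => t y <-; rewrite sgr_le0 subr_le0.
- move=> f IHf g IHg /andP[qf qg] /andP[rf rg].
  have [b bf] := IHf qf rf; have [c cg] := IHg qg rg; exists (b && c).
  by apply: on_cuspW (on_cusp_and bf cg) => t y [-> ->].
- move=> f IHf g IHg /andP[qf qg] /andP[rf rg].
  have [b bf] := IHf qf rf; have [c cg] := IHg qg rg; exists (b || c).
  by apply: on_cuspW (on_cusp_and bf cg) => t y [-> ->].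
- move=> f IHf g IHg /andP[qf qg] /andP[rf rg].
  have [b bf] := IHf qf rf; have [c cg] := IHg qg rg; exists (b ==> c).
  by apply: on_cuspW (on_cusp_and bf cg) => t y [-> ->].
- move=> f IHf qf rf; have [b bf] := IHf qf rf; exists (~~ b).
  by apply: on_cuspW bf => t y ->.
Qed.

End Cusps.

(** A Łojasiewicz inequality at infinity.  If the minimum [m] of [f] over
    [|x|^2 <= t] lay in the cusp, so would [m / 2], and the formula defining the
    values of [f] would be true at [m / 2] as it is at [m], although [m / 2] is
    below the minimum. *)
Lemma semialgebraic_lower_bound (R : realType) (n : nat) (X : set 'rV[R]_n)
    (f : mpoly n R) :
  closed X -> semialgebraic X -> (forall x, X x -> 0 < peval f x) ->
  exists c k, 0 < c /\
    forall x, X x -> c <= peval f x * (1 + enorm x ^+ 2) ^+ k.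
Proof.
move=> Xclosed Xsemialg fpos.
have [theta [qtheta rtheta thetaP]] :=
  values_semialgebraic f (sqnorm_mpoly R n) Xsemialg.
have [b [t0 [c [k [t00 c0 cusp]]]]] := formula_on_cusp qtheta rtheta.
have w0 : 0 < (1 + t0) ^+ k by rewrite exprn_gt0//; lra.
exists (c / (1 + t0) ^+ k), k; split=> [|x Xx]; first exact: divr_gt0.
have r0 : 0 <= enorm x ^+ 2 by rewrite sqr_ge0.
(* Small balls are enlarged to squared radius [t0], where the cusp begins. *)
pose t := Num.max t0 (enorm x ^+ 2).
have tt0 : t0 <= t by rewrite le_max lexx.
pose K := X `&` [set z | enorm z ^+ 2 <= t].
have Kx : K x by split; rewrite //= le_max lexx orbT.
have fK : {within K, continuous (peval f)}.
  exact/continuous_subspaceT/peval_continuous.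
have K0 : K !=set0 by exists x.
have [z] := compact_EVT_min K0 (compact_ball Xclosed) fK.
rewrite inE => -[Xz zt] zmin.
have fz0 := fpos z Xz.
have thetaz : ord.qf_eval [:: t; peval f z] theta.
  by apply/thetaP; exists z; rewrite peval_sqnorm.
have fz : c <= peval f z * (1 + t) ^+ k.
  rewrite leNgt; apply/negP => fzc.
  have w : 0 < (1 + t) ^+ k by rewrite exprn_gt0//; lra.
  have [] : ord.qf_eval [:: t; peval f z / 2] theta.
    rewrite (cusp t (peval f z / 2)) ?divr_gt0//; last by nra.
    by rewrite -(cusp t (peval f z)).
  move/thetaP => [y [Xy]]; rewrite peval_sqnorm => yt fy.
  have : peval f z <= peval f y by apply: zmin; rewrite inE.
  by rewrite fy; lra.
rewrite ler_pdivrMr//; apply: le_trans fz _; rewrite -mulrA -exprMn.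
have fzx : peval f z <= peval f x by apply: zmin; rewrite inE.
apply: ler_pM => //; [exact: ltW|by rewrite exprn_ge0//; lra|].
apply: lerXn2r; rewrite ?nnegrE; [lra|nra|].
have : t <= t0 + enorm x ^+ 2 by rewrite ge_max; apply/andP; split; lra.
nra.
Qed.

(** * Convexity along segments *)

Section Convexity.
Variable R : realType.

Lemma convex_segment (F F1 F2 : R -> R) :
  (forall t : R, is_derive t 1 F (F1 t)) -> (forall t : R, is_derive t 1 F1 (F2 t)) ->
  (forall t, 0 < t < 1 -> 0 <= F2 t) ->
  forall l : {i01 R}, F (1 - l%:num) <= l%:num * F 0 + (1 - l%:num) * F 1.
Proof.
move=> dF dF1 F2ge0 l.
have DF : 'D_1 F = F1 by apply/funext => t; exact: derive_val.
have DF1 : 'D_1 ('D_1 F) = F2.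
  by rewrite DF; apply/funext => t; exact: derive_val.
have cF : continuous F.
  move=> t; apply: differentiable_continuous; apply/derivable1_diffP.
  exact: ex_derive.
have D2ge0 t : 0 < t < 1 -> 0 <= 'D_1 ('D_1 F) t by move: (F2ge0 t); rewrite -DF1.
have dDF t : derivable ('D_1 F) t 1 by rewrite DF; exact: ex_derive.
have := @second_derivative_convex R F 0 1 D2ge0 (cvg_at_left_filter (cF 1))
  (cvg_at_right_filter (cF 0)) (fun t _ => @ex_derive _ _ _ _ _ _ _ (dF t))
  (fun t _ => dDF t) l ler01.
by rewrite !convRE mulr0 add0r mulr1.
Qed.

Lemma is_deriveM1 (f g : R -> R) (t df dg : R) :
  is_derive t 1 f df -> is_derive t 1 g dg ->
  is_derive t 1 (fun s => f s * g s) (df * g t + f t * dg).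
Proof.
move=> Df Dg; apply: (is_derive_eq (is_deriveM Df Dg)).
by rewrite /GRing.scale/= addrC mulrC.
Qed.

Lemma is_derive_expR1 (f : R -> R) (t df : R) :
  is_derive t 1 f df -> is_derive t 1 (fun s => expR (f s)) (expR (f t) * df).
Proof. by move=> Df; exact: (is_derive1_comp (is_derive_expR _) Df). Qed.

Lemma is_deriveMl1 (c : R) (f : R -> R) (t df : R) :
  is_derive t 1 f df -> is_derive t 1 (fun s => c * f s) (c * df).
Proof.
move=> Df; apply: (is_derive_eq (is_deriveM1 (is_derive_cst c t 1) Df)).
by rewrite mul0r add0r.
Qed.

(** The first two derivatives of [exp (exp (N r)) * q - r / 2], given those of
    [q] and [r]. *)
Definition expexp_d1 (N : R) (q q1 r r1 : R -> R) (t : R) : R :=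
  expR (expR (N * r t)) * (expR (N * r t) * (N * r1 t) * q t + q1 t) - 2^-1 * r1 t.

Definition expexp_d2 (N : R) (q q1 q2 r r1 r2 : R -> R) (t : R) : R :=
  let h := expR (N * r t) in
  expR h * ((h * (N * r1 t)) ^+ 2 * q t + h * (N * r1 t) ^+ 2 * q t +
    h * (N * r2 t) * q t + 2 * (h * (N * r1 t)) * q1 t + q2 t) - 2^-1 * r2 t.

Lemma is_derive_expexp N (q q1 r r1 : R -> R) (t : R) :
  is_derive t 1 q (q1 t) -> is_derive t 1 r (r1 t) ->
  is_derive t 1 (fun s => expR (expR (N * r s)) * q s - 2^-1 * r s)
    (expexp_d1 N q q1 r r1 t).
Proof.
move=> Dq Dr; have Dh := is_derive_expR1 (is_deriveMl1 N Dr).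
have DE := is_derive_expR1 Dh.
apply: (is_derive_eq (is_deriveB (is_deriveM1 DE Dq) (is_deriveMl1 2^-1 Dr))).
rewrite /expexp_d1; ring.
Qed.

Lemma is_derive_expexp2 N (q q1 q2 r r1 r2 : R -> R) (t : R) :
  is_derive t 1 q (q1 t) -> is_derive t 1 q1 (q2 t) ->
  is_derive t 1 r (r1 t) -> is_derive t 1 r1 (r2 t) ->
  is_derive t 1 (expexp_d1 N q q1 r r1) (expexp_d2 N q q1 q2 r r1 r2 t).
Proof.
move=> Dq Dq1 Dr Dr1; have Dh := is_derive_expR1 (is_deriveMl1 N Dr).
have DE := is_derive_expR1 Dh.
have Db := is_deriveD (is_deriveM1 (is_deriveM1 Dh (is_deriveMl1 N Dr1)) Dq) Dq1.
apply: (is_derive_eq (is_deriveB (is_deriveM1 DE Db) (is_deriveMl1 2^-1 Dr1))).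
rewrite /expexp_d2 !fctE; ring.
Qed.

(** Here [u] stands for [|v|], [a] and [b] for powers of [1 + |x|^2], the
    former controlling the growth of [q] and its derivatives, the latter its
    decay.  Multiplying the bracket by [q] and completing the square leaves
    [2 N u^2 h q^2], of size at least [2 N c^2 u^2 a^2], against [q1^2] and
    [q * q2], each at most [C^2 u^2 a^2].  The summand [C] in the condition
    on [N] makes the bracket at least [u^2], which pays for the subtracted
    quadratic term. *)
Lemma expexp_d2_ge0 (N c C a b u q q1 q2 h r1 : R) :
  0 < c -> 1 <= C -> 1 <= a -> 1 <= b -> 0 < q -> 0 <= N ->
  c <= q * b -> q <= C * a -> `|q1| <= C * u * a -> `|q2| <= C * u ^+ 2 * a ->
  (a * b) ^+ 2 <= h -> 2 * C ^+ 2 + C <= 2 * N * c ^+ 2 ->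
  0 <= expR h * ((h * (N * r1)) ^+ 2 * q + h * (N * r1) ^+ 2 * q +
    h * (N * (2 * u ^+ 2)) * q + 2 * (h * (N * r1)) * q1 + q2) - 2^-1 * (2 * u ^+ 2).
Proof.
move=> c0 C1 a1 b1 q0 N0 cq qC q1C q2C hab NC.
have h0 : 0 <= h by apply: le_trans hab; rewrite sqr_ge0.
have E1 : 1 <= expR h by rewrite -expR0 ler_expR.
set V := h * (N * r1); set Z := h * (N * r1) ^+ 2 * q.
have Z0 : 0 <= Z by apply: mulr_ge0 (ltW q0); apply: mulr_ge0; rewrite ?sqr_ge0.
set S := (X in expR h * X).
have u2 : 0 <= u ^+ 2 by rewrite sqr_ge0.
have q1sq : q1 ^+ 2 <= C ^+ 2 * u ^+ 2 * a ^+ 2.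
  rewrite -!exprMn -[q1 ^+ 2]real_normK ?num_real// lerXn2r//.
  by rewrite nnegrE (le_trans _ q1C).
have qq2 : - (C ^+ 2 * u ^+ 2 * a ^+ 2) <= q * q2.
  have : `|q * q2| <= C * a * (C * u ^+ 2 * a).
    by rewrite normrM (gtr0_norm q0); apply: ler_pM => //; exact: ltW.
  rewrite ler_norml => /andP[+ _]; apply: le_trans.
  by rewrite lerN2 le_eqVlt; apply/orP; left; apply/eqP; ring.
have hq : a ^+ 2 * c ^+ 2 <= h * q ^+ 2.
  apply: (@le_trans _ _ ((a * b) ^+ 2 * q ^+ 2)); last by rewrite ler_wpM2r ?sqr_ge0.
  have ac0 : 0 <= a * c by apply: mulr_ge0; lra.
  have acq : a * c <= a * b * q.
    by rewrite -mulrA (mulrC b); apply: ler_wpM2l => //; lra.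
  by rewrite -!exprMn lerXn2r ?nnegrE// (le_trans ac0).
have Su : u ^+ 2 <= S.
  rewrite -(ler_pM2l q0).
  have -> : q * S = (V * q + q1) ^+ 2 + q * Z - q1 ^+ 2 + q * q2 +
      2 * N * u ^+ 2 * (h * q ^+ 2) by rewrite /S /Z /V; ring.
  have qZ : 0 <= q * Z by rewrite mulr_ge0// ltW.
  have sq : 0 <= (V * q + q1) ^+ 2 by rewrite sqr_ge0.
  have : 2 * N * u ^+ 2 * (a ^+ 2 * c ^+ 2) <= 2 * N * u ^+ 2 * (h * q ^+ 2).
    by apply: ler_wpM2l => //; apply: mulr_ge0 => //; apply: mulr_ge0.
  have : (2 * C ^+ 2 + C) * (u ^+ 2 * a ^+ 2) <= 2 * N * c ^+ 2 * (u ^+ 2 * a ^+ 2).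
    by rewrite ler_wpM2r// mulr_ge0 ?sqr_ge0.
  have : q * u ^+ 2 <= C * a ^+ 2 * u ^+ 2.
    rewrite ler_wpM2r//; apply: le_trans qC _; rewrite ler_wpM2l//; first lra.
    nra.
  lra.
nra.
Qed.

End Convexity.

(** The Hessian of [|x|^2] is twice the identity; this is what makes the second
    derivative of the exponent bounded below along every direction. *)
Lemma sqnorm_line (R : realType) (n : nat) (x v : 'rV[R]_n) :
  exists2 P : {poly R}, (fun t => enorm (x + t *: v) ^+ 2) = horner P &
    P^`()^`() = (2 * enorm v ^+ 2)%:P.
Proof.
exists ((enorm x ^+ 2)%:P + (2 * \sum_(i < n) x ord0 i * v ord0 i) *: 'X
  + enorm v ^+ 2 *: 'X^2).
  apply/funext => t; rewrite !hornerE !enorm_sqr mulr_sumr.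
  rewrite !mulr_suml -big_split/= !mulr_suml -big_split/=.
  by apply: eq_bigr => i _ /=; rewrite !mxE; ring.
rewrite !(derivD, derivC, derivZ, derivX, derivXn, derivMn)/= expr0.
by rewrite scaler0 !add0r -polyC1 -polyCD -mul_polyC -polyCM mulrC.
Qed.

Theorem theorem1 (R : realType) (n : nat) (X : set 'rV[R]_n)
    (f : mpoly.mpoly n R) (Xclosed : closed X) (Xconvex : convex_set X)
    (Xsemialg : semialgebraic X) (fpos : forall x, X x -> 0 < peval f x) :
  exists N0 : R, forall N : R, N0 <= N -> strongly_convex X (Phi f N).
Proof.
have [c [k [c0 flower]]] := semialgebraic_lower_bound Xclosed Xsemialg fpos.
have [C0 [k0 [C00 fb]]] := poly_bounded_peval f.
have [C1 [k1 [C10 f1b]]] := poly_bounded_dirderiv f.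
have [C2 [k2 [C20 f2b]]] := poly_bounded_dirderiv2 f.
pose C := 1 + C0 + C1 + C2; pose m := (k0 + k1 + k2)%N.
have C1le : 1 <= C by rewrite /C; lra.
(* The first bound makes [exp (N |x|^2)] dominate [((1 + |x|^2)^(m + k))^2],
   the second makes [2 N c^2] absorb the constants of [expexp_d2_ge0]. *)
exists (Num.max ((m + k) * 2)%N%:R ((2 * C ^+ 2 + C) / (2 * c ^+ 2))) => N.
rewrite ge_max => /andP[Nk NC].
have N0 : 0 <= N by apply: le_trans Nk.
have {NC} NC : 2 * C ^+ 2 + C <= 2 * N * c ^+ 2.
  by move: NC; rewrite ler_pdivrMr ?mulr_gt0 ?exprn_gt0//; lra.
exists 1 => // l x y xX yX.
(* In [conv l x y] the weight [l] is on [x], so it is the point of parameter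
   [1 - l] on the line from [x] to [y]. *)
pose v := y - x; pose z (t : R) := x + t *: v.
have zconv (s : {i01 R}) : z (1 - s%:num) = conv s x y.
  by rewrite /z /v scalerBr addrCA addrC [X in _ - X]scalerBl scale1r subKr.
have Xz t : 0 < t < 1 -> X (z t).
  move=> /andP[t0 t1]; have t1' : 0 <= 1 - t by lra.
  have t0' : 1 - t <= 1 by lra.
  have := Xconvex x y (Itv01 t1' t0') xX yX.
  by rewrite inE -zconv/= subKr.
have [P rP P2] := sqnorm_line x v.
pose q t := peval f (z t); pose q1 t := peval (dirderiv v f) (z t).
pose q2 t := peval (dirderiv v (dirderiv v f)) (z t).
have Dq (t : R) : is_derive t 1 q (q1 t) by exact: is_derive_peval_line.
have Dq1 (t : R) : is_derive t 1 q1 (q2 t) by exact: is_derive_peval_line.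
have Dr (t : R) : is_derive t 1 (horner P) (P^`().[t]) by exact: is_derive_poly.
have Dr1 (t : R) : is_derive t 1 (horner P^`()) (P^`()^`().[t]).
  exact: is_derive_poly.
have DF (t : R) := is_derive_expexp N (Dq t) (Dr t).
have DF1 (t : R) := is_derive_expexp2 N (Dq t) (Dq1 t) (Dr t) (Dr1 t).
have F2ge0 t : 0 < t < 1 ->
    0 <= expexp_d2 N q q1 q2 (horner P) (horner P^`()) (horner P^`()^`()) t.
  move=> t01; rewrite /expexp_d2 P2 hornerC.
  have {t01} Xzt := Xz t t01.
  have W1 := weight_ge1 (z t); set W := 1 + enorm (z t) ^+ 2 in W1.
  have u0 := enorm_ge0 v.
  have CW (d : R) (K : nat) D : 0 <= d -> 0 <= D -> D <= C -> (K <= m)%N ->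
      D * d * W ^+ K <= C * d * W ^+ m.
    move=> d0 D0 DC Km; apply: ler_pM => //.
    - exact: mulr_ge0.
    - by rewrite exprn_ge0//; lra.
    - exact: ler_wpM2r.
    - exact: ler_weXn2l.
  apply: (@expexp_d2_ge0 R N c C (W ^+ m) (W ^+ k)) => //.
  - exact: exprn_ege1.
  - exact: exprn_ege1.
  - exact: fpos.
  - exact: flower.
  - rewrite -[C]mulr1; apply: le_trans (ler_norm _) _; apply: le_trans (fb v _) _.
    by rewrite expr0; apply: CW => //; rewrite ?/C ?/m -?addnA ?leq_addr//; lra.
  - apply: le_trans (f1b v _) _; rewrite expr1; apply: CW => //; rewrite ?/C; first lra.
    by rewrite /m addnAC leq_addl.
  - apply: le_trans (f2b v _) _; apply: CW => //; rewrite ?exprn_ge0 ?/C//; first lra.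
    by rewrite /m leq_addl.
  - rewrite -exprD -exprM.
    apply: (@le_trans _ _ (expR (((m + k) * 2)%N%:R * P.[t]))); last first.
      rewrite ler_expR ler_wpM2r//.
      by rewrite -(congr1 (fun g => g t) rP) sqr_ge0.
    rewrite mulrC expRM_natr lerXn2r ?nnegrE ?expR_ge0//; first lra.
    rewrite /W /z -/(z t) (congr1 (fun g => g t) rP).
    exact: expR_ge1Dx.
pose F s := Phi f N (z s) - 1 / 2 * enorm (z s) ^+ 2.
have FE : (fun s => expR (expR (N * P.[s])) * q s - 2^-1 * P.[s]) = F.
  by apply/funext => s; rewrite /F div1r /Phi -(congr1 (fun g => g s) rP).
rewrite FE in DF.
have := convex_segment DF DF1 F2ge0 l.
have z0 : z 0 = x by rewrite /z scale0r addr0.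
have z1 : z 1 = y by rewrite /z scale1r subrKC.
by rewrite /F zconv z0 z1.
Qed.
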